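(* Let $D$ be an MCD-domain. Then the following conditions are equivalent. (a) $D$ is a pre-Schreier domain. (b) $D$ is a PSP-domain. (c) $D$ is a GL-domain.
   Context: Let $D$ be an integral domain with field of fractions $F$. MCD-domain: For a nonempty set $S$ of nonzero elements of $D$, a maximal common divisor (MCD) of $S$ is a common divisor $d \in D$ of $S$ such that for every common divisor $d' \in D$ of $S$, if $d$ divides $d'$ in $D$ then $d$ and $d'$ are associates. $D$ is an MCD-domain if every nonempty finite set of nonzero elements of $D$ has a maximal common divisor in $D$. Pre-Schreier domain: A nonzero nonunit $p \in D$ is primal if whenever $p$ divides $rs$ in $D$ for some $r,s \in D$, one can write $p = r's'$ for some $r',s' \in D$ such that $r'$ divides $r$ and $s'$ divides $s$ in $D$. $D$ is pre-Schreier if every nonzero nonunit of $D$ is primal. PSP-domain and GL-domain: For a nonzero polynomial $f \in D[X]$, let $I_f$ be the ideal of $D$ generated by the coefficients of $f$, and put $I_f^{-1} := \{q \in F : qI_f \subseteq D\}$. The polynomial $f$ is primitive over $D$ if $I_f$ is not contained in any proper principal ideal of $D$ (equivalently, the only common divisors in $D$ of the coefficients of $f$ are the units of $D$), and $f$ is super-primitive over $D$ if $I_f^{-1} = D$. $D$ is a PSP-domain if every primitive polynomial over $D$ is super-primitive. $D$ is a GL-domain if the product of any two primitive polynomials over $D$ is again primitive over $D$. *)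

(* Defs.v *)
From mathcomp Require Import all_boot all_algebra.
From mathcomp Require Import classical_sets cardinality.

Set Implicit Arguments.
Unset Strict Implicit.
Unset Printing Implicit Defensive.

Import GRing.Theory.
Local Open Scope classical_set_scope.
Local Open Scope ring_scope.

Section Divisibility.
Variable D : idomainType.
Implicit Types (S : set D) (a b d : D).

Definition divides a b : Prop := exists c, b = a * c.

Definition associates a b : Prop := exists2 u, u \is a GRing.unit & b = a * u.

Definition common_divisor S d : Prop := forall x, S x -> divides d x.

Definition is_MCD S d : Prop :=
  common_divisor S d /\
  forall d', common_divisor S d' -> divides d d' -> associates d d'.

Definition primal p : Prop :=
  forall r s, divides p (r * s) ->
    exists r' s', [/\ p = r' * s', divides r' r & divides s' s].

End Divisibility.

Section Ideals.
Variable D : idomainType.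
Implicit Types (S I : set D) (f : {poly D}).

(* Ideals are allowed to be all of D, unlike the ideals of ring_quotient,
   which are proper by definition. *)
Definition is_ideal I : Prop :=
  I 0 /\ forall a x y, I x -> I y -> I (a * x + y).

Definition ideal_gen S : set D := smallest is_ideal S.

Definition coef_ideal f : set D := ideal_gen [set c | c \in (f : seq D)].

Definition ideal_inv I : set {fraction D} :=
  [set q | [set q * tofrac x | x in I] `<=` range (@tofrac D)].

Definition primitive f : Prop :=
  f != 0 /\
  forall a, ideal_gen [set a] <> setT ->
    ~ (coef_ideal f `<=` ideal_gen [set a]).

(* D is identified with its image in its field of fractions. *)
Definition super_primitive f : Prop :=
  f != 0 /\ ideal_inv (coef_ideal f) = range (@tofrac D).

End Ideals.

Definition MCD_domain (D : idomainType) : Prop :=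
  forall S : set D, finite_set S -> S !=set0 -> ~ S 0 ->
    exists d, is_MCD S d.

Definition pre_Schreier (D : idomainType) : Prop :=
  forall p : D, p != 0 -> p \isn't a GRing.unit -> primal p.

Definition PSP_domain (D : idomainType) : Prop :=
  forall f : {poly D}, primitive f -> super_primitive f.

Definition GL_domain (D : idomainType) : Prop :=
  forall f g : {poly D}, primitive f -> primitive g -> primitive (f * g).

(* Main.v *)
(** (a) => (b): splitting [y], which divides every [x * c], against one
    coefficient [c] after the other, yields [y = y1 * y2] with [y1] dividing [x]
    and [y2] dividing every coefficient.

    (b) => (c): a Dedekind-Mertens argument. If [y] divides [f * g], then [y]
    divides every product of a coefficient of [f] and a coefficient of [g];
    super-primitivity of [f] then removes the coefficients of [f].

    (c) => (a): applied to [a + b X] and [a + c X], the GL property says that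
    elements coprime to [a] are closed under product. If [p] divides [r * s],
    remove from [p] a maximal common divisor with [r], then one of what remains
    with [s]; what is left of [p] is coprime to both cofactors and divides
    their product, hence is a unit. *)

Require Import Defs.
From mathcomp Require Import all_boot all_algebra.
From mathcomp Require Import classical_sets cardinality.
From mathcomp Require Import ring.

Set Implicit Arguments.
Unset Strict Implicit.
Unset Printing Implicit Defensive.

Import GRing.Theory.
Local Open Scope classical_set_scope.
Local Open Scope ring_scope.
Local Open Scope quotient_scope.

Lemma fraction_eq_div (D : idomainType) (q : {fraction D}) :
  exists x y, y != 0 /\ q = tofrac x / tofrac y.
Proof.
elim/quotW: q => r; exists \n_r, \d_r; split; first exact: denom_ratioP.
have d0 : \d_r != 0 by exact: denom_ratioP.
apply: (@mulIf _ (tofrac \d_r)); first by rewrite tofrac_eq0.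
rewrite divfK ?tofrac_eq0 //.
unlock tofrac; rewrite -[LHS]FracField.pi_mul; apply/eqmodP.
by rewrite /= FracField.equivfE /FracField.mulf
  !numden_Ratio ?mulr1 ?oner_neq0 // mulrC.
Qed.

(** * Divisibility in [D] and the two primitivity conditions *)

Section Divides.
Variable D : idomainType.
Implicit Types (a b c d x y : D) (f g : {poly D}).

Lemma divides_refl a : divides a a.
Proof. by exists 1; rewrite mulr1. Qed.

Lemma divides_trans a b c : divides a b -> divides b c -> divides a c.
Proof. by move=> [u ->] [v ->]; exists (u * v); rewrite mulrA. Qed.

Lemma divides0 a : divides a 0.
Proof. by exists 0; rewrite mulr0. Qed.

Lemma unit_divides a b : a \is a GRing.unit -> divides a b.
Proof. by move=> ua; exists (a^-1 * b); rewrite mulVKr. Qed.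

Lemma divides1 a : divides a 1 -> a \is a GRing.unit.
Proof. by move=> [u e]; apply/unitrPr; exists u. Qed.

Lemma divides_mulr a b c : divides a b -> divides a (b * c).
Proof. by move=> [u ->]; exists (u * c); rewrite mulrA. Qed.

Lemma divides_mull a b c : divides a b -> divides a (c * b).
Proof. by rewrite mulrC; exact: divides_mulr. Qed.

Lemma divides_mul2l a b c : divides b c -> divides (a * b) (a * c).
Proof. by move=> [u ->]; exists u; rewrite mulrA. Qed.

Lemma divides_mul2lK a b c : a != 0 -> divides (a * b) (a * c) -> divides b c.
Proof. by move=> a0 [u]; rewrite -mulrA => /(mulfI a0) ->; exists u. Qed.

Lemma dividesD a b c : divides a b -> divides a c -> divides a (b + c).
Proof. by move=> [u ->] [v ->]; exists (u + v); rewrite mulrDr. Qed.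

Lemma dividesB a b c : divides a b -> divides a c -> divides a (b - c).
Proof. by move=> [u ->] [v ->]; exists (u - v); rewrite mulrBr. Qed.

Lemma divides_sum a (I : Type) (r : seq I) (P : pred I) (F : I -> D) :
  (forall i, P i -> divides a (F i)) -> divides a (\sum_(i <- r | P i) F i).
Proof. by apply: big_ind; [exact: divides0 | exact: dividesD]. Qed.

Lemma is_ideal_divides a : is_ideal [set x | divides a x].
Proof.
split=> [|b x y ax ay] /=; first exact: divides0.
by apply: dividesD => //; exact: divides_mull.
Qed.

Lemma is_ideal_gen (S : set D) : is_ideal (ideal_gen S).
Proof.
split=> [|a x y Sx Sy] I /= [idI SI]; first exact: idI.1.
by apply: idI.2; [exact: Sx | exact: Sy].
Qed.

Lemma ideal_gen1 a : ideal_gen [set a] = [set x | divides a x].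
Proof.
apply/seteqP; split.
  apply: smallest_sub; first exact: is_ideal_divides.
  by move=> x ->; exact: divides_refl.
move=> x [c ->]; rewrite mulrC -[c * a]addr0.
have [gen0 genD] := is_ideal_gen [set a].
by apply: genD => //; exact: sub_gen_smallest.
Qed.

Lemma coef_in_coef_ideal f i : coef_ideal f f`_i.
Proof.
have [lt_i_f | le_f_i] := ltnP i (size f).
  by apply: sub_gen_smallest; exact: mem_nth.
by rewrite nth_default //; exact: (is_ideal_gen _).1.
Qed.

(** The index may range over all naturals: beyond the size a coefficient is [0], which lies in every
    ideal. *)
Lemma coef_ideal_subP (I : set D) f : is_ideal I ->
  coef_ideal f `<=` I <-> forall i, I f`_i.
Proof.
move=> idI; split=> [sub i | If].
  by apply: sub; exact: coef_in_coef_ideal.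
by apply: smallest_sub => // c /= /(nthP 0) [i _ <-].
Qed.

Lemma primitiveP f : primitive f <->
  f != 0 /\ forall a, (forall i, divides a f`_i) -> a \is a GRing.unit.
Proof.
split=> -[f0 prf]; split=> // a.
  move=> af; apply/negPn/negP => na; apply: (prf a).
    rewrite ideal_gen1 => aT; case/negP: na; apply: divides1.
    by have : [set: D] 1 by []; rewrite -aT.
  by rewrite ideal_gen1; apply/(coef_ideal_subP _ (is_ideal_divides a)).
move=> aT; rewrite ideal_gen1 => /(coef_ideal_subP _ (is_ideal_divides a)) af.
apply: aT; rewrite ideal_gen1; apply/seteqP; split=> // x _.
by apply/unit_divides/prf.
Qed.

(** Write an element of the fraction field as [x / y]: it multiplies [coef_ideal f] into [D] iff [y]
    divides every [x * f_i], and it lies in [D] iff [y] divides [x]. *)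
Lemma super_primitiveP f : super_primitive f <->
  f != 0 /\ forall x y, y != 0 ->
    (forall i, divides y (x * f`_i)) -> divides y x.
Proof.
split=> -[f0 spf]; split=> //.
  move=> x y y0 yxf; have yF0 : tofrac y != 0 by rewrite tofrac_eq0.
  have : ideal_inv (coef_ideal f) (tofrac x / tofrac y).
    move=> _ [z fz <-].
    have [u e] : divides y (x * z).
      have idI : is_ideal [set z | divides y (x * z)].
        split=> [|b z1 z2 /= yz1 yz2] /=.
          by rewrite mulr0; exact: divides0.
        by rewrite mulrDr mulrCA; apply: dividesD => //; exact: divides_mull.
      by move/(coef_ideal_subP f idI): yxf; apply.
    exists u => //; rewrite mulrAC -tofracM e tofracM mulrAC divff //.
    by rewrite mul1r.
  rewrite spf => -[u _ e]; exists u; apply/eqP.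
  by rewrite -tofrac_eq tofracM e mulrC divfK.
apply/seteqP; split=> [q qf | _ [u _ <-] _ [z _ <-]]; last first.
  by exists (u * z) => //; rewrite tofracM.
have [x [y [y0 q_xy]]] := fraction_eq_div q.
have yF0 : tofrac y != 0 by rewrite tofrac_eq0.
have [u x_def] : divides y x.
  apply: spf => // i.
  have [|u _ e] := qf (q * tofrac f`_i).
    by exists f`_i => //; exact: coef_in_coef_ideal.
  exists u; apply/eqP; rewrite -tofrac_eq !tofracM e q_xy mulrA.
  by rewrite [tofrac y * _]mulrC divfK.
by exists u => //; rewrite q_xy x_def tofracM mulrAC divff ?mul1r.
Qed.

End Divides.

(** * Pre-Schreier domains are PSP *)

Lemma pre_Schreier_split (D : idomainType) (s : seq D) (x y : D) :
  pre_Schreier D -> y != 0 -> (forall c, c \in s -> divides y (x * c)) ->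
  exists y1 y2,
    [/\ y = y1 * y2, divides y1 x & forall c, c \in s -> divides y2 c].
Proof.
move=> preS y0; elim: s => [|c s IHs] yxs.
  exists 1, y; split=> //; first by rewrite mul1r.
  exact/unit_divides/unitr1.
have [|y1 [y2 [y12 [x' x_def] y2s]]] := IHs.
  by move=> d ds; apply: yxs; rewrite inE ds orbT.
have [y1_0 y2_0] : y1 != 0 /\ y2 != 0.
  by apply/andP; rewrite -negb_or -mulf_eq0 -y12.
have y2xc : divides y2 (x' * c).
  apply: (divides_mul2lK y1_0); rewrite -y12 mulrA -x_def.
  by apply: yxs; rewrite mem_head.
have [r [t [y2_def r_x' t_c]]] :
    exists r t, [/\ y2 = r * t, divides r x' & divides t c].
  (* [pre_Schreier] speaks of nonunits only; a unit [y2] divides [x'] outright. *)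
  have [u2 | nu2] := boolP (y2 \is a GRing.unit); last exact: preS y2xc.
  exists y2, 1; split; [by rewrite mulr1 | exact: unit_divides |].
  exact/unit_divides/unitr1.
(* The factor [r] of [y2] joins [y1], as [y1 * r] divides [y1 * x' = x]; the rest [t] still divides
   the earlier coefficients. *)
exists (y1 * r), t; split; first by rewrite y12 y2_def mulrA.
  by rewrite x_def; exact: divides_mul2l.
move=> d; rewrite inE => /predU1P[-> // | /y2s].
by apply: divides_trans; rewrite y2_def; apply/divides_mull/divides_refl.
Qed.

Lemma pre_Schreier_PSP (D : idomainType) : pre_Schreier D -> PSP_domain D.
Proof.
move=> preS f /primitiveP[f0 prf]; apply/super_primitiveP; split=> //.
move=> x y y0 yxf.
have [|y1 [y2 [-> y1x y2f]]] := @pre_Schreier_split D f x y preS y0.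
  by move=> c /(nthP 0)[i _ <-]; exact: yxf.
have u2 : y2 \is a GRing.unit.
  apply: prf => i; have [lt_i_f | le_f_i] := ltnP i (size f).
    by apply: y2f; exact: mem_nth.
  by rewrite nth_default //; exact: divides0.
by have [u ->] := y1x; apply: divides_mul2l; exact: unit_divides.
Qed.

(** * PSP domains are GL *)

Lemma super_primitive_divides_mul (D : idomainType) (f g : {poly D}) (y : D) :
  super_primitive f -> y != 0 ->
  (forall i, divides y (f * g)`_i) -> forall i, divides y g`_i.
Proof.
move=> /super_primitiveP[_ spf] y0.
(* Induction on a bound for the size, since [g] will be replaced by a multiple of its truncation. *)
move: g; suff le_n n (g : {poly D}) : (size g <= n)%N ->
    (forall i, divides y (f * g)`_i) -> forall i, divides y g`_i.
  by move=> g; exact: (le_n (size g)).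
elim: n g => [|n IHn] g le_gn yfg.
  by move=> i; rewrite nth_default ?(leq_trans le_gn) //; exact: divides0.
(* Descending induction on [i]: [y] divides [f_i * g], first in degree [n] by
   reading the coefficient of degree [i + n] in [f * g], and then in lower
   degrees by the induction hypothesis applied to [f_i * take_poly n g]. *)
suff yfi k i : (size f <= i + k)%N -> forall j, divides y (f`_i * g`_j).
  move=> j; apply: spf => // i; rewrite mulrC.
  exact: (yfi (size f) i (leq_addl _ _)).
elim: k i => [|k IHk] i le_f_ik j.
  rewrite addn0 in le_f_ik.
  by rewrite nth_default // mul0r; exact: divides0.
have yfign : divides y (f`_i * g`_n).
  have lt_i : (i < (i + n).+1)%N by rewrite ltnS leq_addr.
  have := yfg (i + n)%N; rewrite coefM (bigD1 (Ordinal lt_i)) //= addKn.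
  set rest := \sum_(_ < _ | _) _ => ytot.
  suff : divides y rest by move=> /(dividesB ytot); rewrite addrK.
  (* For [m < i] the index [i + n - m] exceeds [n], so the coefficient of [g] is [0]; for [m > i]
     the descending induction applies. *)
  apply: divides_sum => m m_neq_i.
  have [lt_mi | le_im] := ltnP m i.
    rewrite [g`_ _]nth_default ?mulr0; first exact: divides0.
    rewrite (leq_trans le_gn) // -addnBAC ?(ltnW lt_mi) //.
    by rewrite -{1}[n]add0n ltn_add2r subn_gt0.
  apply: IHk; rewrite (leq_trans le_f_ik) // addnS -addSn leq_add2r.
  by rewrite ltn_neqAle le_im andbT eq_sym.
have [lt_jn | lt_nj | ->//] := ltngtP j n; last first.
  by rewrite [g`_ _]nth_default ?mulr0 ?(leq_trans le_gn) //; exact: divides0.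
have := IHn (f`_i *: take_poly n g).
rewrite (leq_trans (size_scale_leq _ _)) ?size_take_poly // => /(_ isT _ j).
rewrite coefZ coef_take_poly lt_jn; apply=> m.
(* Removing the top term of [g] costs [f_i * g_n] times a shift of [f], and [y] divides
   [f_i * g_n]. *)
have -> : f * (f`_i *: take_poly n g) =
    f`_i *: (f * g) - (f`_i * g`_n) *: (f * 'X^n).
  have drop_g : drop_poly n g = (g`_n)%:P.
    apply/polyP => l; rewrite coef_drop_poly coefC; case: l => [|l] //=.
    by rewrite nth_default // (leq_trans le_gn) // addSn ltnS leq_addl.
  rewrite -{2}(poly_take_drop n g) drop_g -!mul_polyC polyCM; ring.
rewrite coefB !coefZ; apply: dividesB; first exact: divides_mull.
exact: divides_mulr.
Qed.

Lemma PSP_GL (D : idomainType) : PSP_domain D -> GL_domain D.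
Proof.
move=> pspD f g /[dup] prf /primitiveP[f0 _] /primitiveP[g0 prg].
apply/primitiveP; split=> [|a afg]; first exact: mulf_neq0.
have a0 : a != 0.
  apply: contraNneq (mulf_neq0 f0 g0) => a0; apply/eqP/polyP => i.
  by have [u ->] := afg i; rewrite a0 mul0r coef0.
exact: prg (super_primitive_divides_mul (pspD f prf) a0 afg).
Qed.

(** * GL domains with maximal common divisors are pre-Schreier *)

Definition coprime_in (D : idomainType) (a b : D) : Prop :=
  forall e, divides e a -> divides e b -> e \is a GRing.unit.

Lemma GL_coprime_mul (D : idomainType) (a b c : D) :
  GL_domain D -> a != 0 -> coprime_in a b -> coprime_in a c ->
  coprime_in a (b * c).
Proof.
move=> glD a0 ab ac.
have prim d : coprime_in a d -> primitive (a%:P + d%:P * 'X).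
  move=> ad; apply/primitiveP; split=> [|e ed].
    apply: contraNneq a0 => /(congr1 (coefp 0)).
    by rewrite /= !coefE mulr0 addr0 => ->.
  by apply: ad; [have := ed 0 | have := ed 1];
    rewrite !coefE ?mulr0 ?mulr1 ?addr0 ?add0r.
have /primitiveP[_ prbc] := glD _ _ (prim b ab) (prim c ac).
move=> e ea ebc; apply: prbc => i.
(* Modulo [a] only the term [b * c] survives, so a common divisor of [a] and [b * c] divides every
   coefficient. *)
have -> : (a%:P + b%:P * 'X) * (a%:P + c%:P * 'X) =
    a *: (a%:P + (b + c)%:P * 'X) + (b * c) *: 'X^2.
  by rewrite -!mul_polyC polyCM polyCD; ring.
rewrite coefD !coefZ; apply: dividesD; exact: divides_mulr.
Qed.

(** Take [d] a maximal common divisor. If [e] divides both cofactors, then [d * e] is a common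
    divisor above [d], hence associate to [d], and cancelling [d] makes [e] a unit. *)
Lemma MCD_cofactors (D : idomainType) (a b : D) : MCD_domain D ->
  a != 0 -> b != 0 ->
  exists d a' b', [/\ a = d * a', b = d * b' & coprime_in a' b'].
Proof.
move=> mcdD a0 b0.
have [||| d [d_ab maxd]] := mcdD [set a; b].
- exact: finite_set2.
- by exists a; left.
- by case=> /esym/eqP; apply/negP.
have [a' a_def] : divides d a by apply: d_ab; left.
have [b' b_def] : divides d b by apply: d_ab; right.
exists d, a', b'; split=> // e ea eb.
have d0 : d != 0 by apply: contraNneq a0 => d0; rewrite a_def d0 mul0r.
have [||u uu /(mulfI d0)->//] := maxd (d * e).
  by move=> _ [->|->]; rewrite ?a_def ?b_def; exact: divides_mul2l.
by apply/divides_mulr/divides_refl.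
Qed.

Lemma MCD_GL_pre_Schreier (D : idomainType) :
  MCD_domain D -> GL_domain D -> pre_Schreier D.
Proof.
move=> mcdD glD p p0 _ r s prs.
(* Maximal common divisors are available for nonzero elements only. *)
have [->|r0] := eqVneq r 0.
  exists p, 1; split; [by rewrite mulr1 | exact: divides0 |].
  exact/unit_divides/unitr1.
have [->|s0] := eqVneq s 0.
  exists 1, p; split; [by rewrite mul1r | | exact: divides0].
  exact/unit_divides/unitr1.
have [d [p1 [r1 [p_def r_def cop1]]]] := MCD_cofactors mcdD p0 r0.
have [d0 p1_0] : d != 0 /\ p1 != 0.
  by apply/andP; rewrite -negb_or -mulf_eq0 -p_def.
have [e [p2 [s2 [p1_def s_def cop2]]]] := MCD_cofactors mcdD p1_0 s0.
have [e0 p2_0] : e != 0 /\ p2 != 0.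
  by apply/andP; rewrite -negb_or -mulf_eq0 -p1_def.
have p2_rs : divides p2 (r1 * s2).
  apply: (divides_mul2lK e0); rewrite -p1_def mulrCA -s_def.
  by apply: (divides_mul2lK d0); rewrite -p_def mulrA -r_def.
have cop2r : coprime_in p2 r1.
  move=> c cp2; apply: cop1; rewrite p1_def; exact: divides_mull.
have u2 : p2 \is a GRing.unit.
  exact: (GL_coprime_mul glD p2_0 cop2r cop2) (divides_refl _) p2_rs.
(* As [p2] is a unit, [p1 = e * p2] divides [s = e * s2]. *)
exists d, p1; split=> //; first by rewrite r_def; apply/divides_mulr/divides_refl.
by rewrite p1_def s_def; apply: divides_mul2l; exact: unit_divides.
Qed.

Theorem theorem3p5 (D : idomainType) (mcdD : MCD_domain D) :
  [<-> pre_Schreier D; PSP_domain D; GL_domain D].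
Proof.
tfae; [exact: pre_Schreier_PSP | exact: PSP_GL | exact: MCD_GL_pre_Schreier].
Qed.
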